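(* Fix $m\ge 0$. Let $L^*$ be the set of elements $(r^2+r)g(r^2)$ of $\mathbb{Z}/2[r]$ with $g\in\mathbb{Z}/2[t]$ of degree $\le 4m+3$, and let $K_m=\{f\in L^*: U(f)=f\}$. Then $\dim_{\mathbb{Z}/2}K_m\ge m+1$.
   Context: $\mathbb{Z}/2[r]$, $\mathbb{Z}/2[t]$ are polynomial rings over the field with two elements. Let $F=r(r+1)^3$ and $G=r^3(r+1)$. $\mathbb{Z}/2[r]$ is a free $\mathbb{Z}/2[G]$-module with basis $1,r,r^2,r^3$. Let $U:\mathbb{Z}/2[r]\to\mathbb{Z}/2[r]$ be the map $U\big(\sum_{i=0}^3 g_i(G)r^i\big)=\sum_{i=0}^3 g_i(F)\,U(r^i)$ (for polynomials $g_i$ over $\mathbb{Z}/2$), where $U(1)=1$, $U(r)=r$, $U(r^2)=r^2$, $U(r^3)=r^3+r^2+r$. *)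

(* Defs.v *)
From HB Require Import structures.
From mathcomp Require Import all_boot all_order all_algebra.
From mathcomp Require Import zify.

Set Implicit Arguments.
Unset Strict Implicit.
Unset Printing Implicit Defensive.

Import GRing.Theory.
Local Open Scope ring_scope.

(* Z/2[r] is {poly 'F_2}, with r written 'X. *)

Definition F : {poly 'F_2} := 'X * ('X + 1) ^+ 3.
Definition G : {poly 'F_2} := 'X ^+ 3 * ('X + 1).

(* The polynomial g_i in the expansion p = \sum_(i < 4) g_i(G) * r^i: its j-th
   coefficient is the r^i-coefficient of the j-th digit of p in base G.  See
   Gcoord_sum and Gcoord_uniq. *)
Definition Gcoord (i : 'I_4) (p : {poly 'F_2}) : {poly 'F_2} :=
  \poly_(j < size p) ((p %/ G ^+ j) %% G)`_i.

Definition U_basis : 4.-tuple {poly 'F_2} :=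
  [tuple 1; 'X; 'X^2; 'X^3 + 'X^2 + 'X].

Definition U (p : {poly 'F_2}) : {poly 'F_2} :=
  \sum_(i < 4) (Gcoord i p \Po F) * tnth U_basis i.

Definition Lstar_elt (g : {poly 'F_2}) : {poly 'F_2} :=
  ('X^2 + 'X) * (g \Po 'X^2).

(* Elements of L^* have degree at most 8m+8 (size_Lstar_elt), and U does not
   raise degrees (size_U), so the truncations npolyp below are the identity;
   deg g <= 4m+3 is size g <= 4m+4.  See mem_Lstar and mem_K. *)
Definition Lstar (m : nat) : {vspace {poly_(8 * m + 9) 'F_2}} :=
  limg (linfun (fun g : {poly_(4 * m + 4) 'F_2} =>
                  npolyp (8 * m + 9) (Lstar_elt g))).

Definition K (m : nat) : {vspace {poly_(8 * m + 9) 'F_2}} :=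
  (Lstar m :&: fixedSpace (linfun (fun f : {poly_(8 * m + 9) 'F_2} =>
                                     npolyp (8 * m + 9) (U f))))%VS.

Lemma monic_Xadd1 : ('X + 1 : {poly 'F_2}) \is monic.
Proof. by rewrite -[1](opprK 1) -polyC1 -polyCN monicXsubC. Qed.

Lemma size_Xadd1 : size ('X + 1 : {poly 'F_2}) = 2%N.
Proof. by rewrite -polyC1 size_XaddC. Qed.

Lemma size_F : size F = 5%N.
Proof.
rewrite /F size_monicM ?monicX ?expf_neq0 ?monic_neq0 ?monic_Xadd1 // size_polyX.
have := size_exp ('X + 1 : {poly 'F_2}) 3; rewrite size_Xadd1.
have : (0 < size (('X + 1 : {poly 'F_2}) ^+ 3)%R)%N.
  by rewrite size_poly_gt0 expf_neq0 ?monic_neq0 ?monic_Xadd1.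
by move=> s_gt0 s_pred; rewrite -(prednK s_gt0) s_pred.
Qed.

Lemma size_G : size G = 5%N.
Proof.
by rewrite /G size_Mmonic ?monic_Xadd1 ?size_polyXn ?size_Xadd1 //
           monic_neq0 // monicXn.
Qed.

Lemma G_neq0 : G != 0.
Proof. by rewrite -size_poly_eq0 size_G. Qed.

Lemma size_GX j : size (G ^+ j) = (4 * j).+1%N.
Proof.
by rewrite -[LHS]prednK ?size_exp ?size_G // size_poly_gt0 expf_neq0 // G_neq0.
Qed.

Lemma coef_Gcoord i p j : (Gcoord i p)`_j = ((p %/ G ^+ j) %% G)`_i.
Proof.
rewrite coef_poly; case: ltnP => // le_pj.
by rewrite divp_small ?mod0p ?coef0 // size_GX ltnS (leq_trans le_pj) ?leq_pmull.
Qed.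

Lemma Gcoord_is_linear i : linear (Gcoord i).
Proof.
move=> a p q; apply/polyP=> j.
rewrite coefD coefZ !coef_Gcoord divpD divpZl modpD modpZl.
by rewrite coefD coefZ.
Qed.
HB.instance Definition _ i :=
  GRing.isLinear.Build 'F_2 {poly 'F_2} {poly 'F_2} _ (Gcoord i)
    (Gcoord_is_linear i).

Lemma Gcoord_small i (p : {poly 'F_2}) :
  (size p <= 4)%N -> Gcoord i p = (p`_i)%:P.
Proof.
move=> sp; apply/polyP=> j; rewrite coef_Gcoord coefC.
case: j => [|j] /=; first by rewrite expr0 divp1 modp_small // size_G.
by rewrite divp_small ?mod0p ?coef0 // size_GX (leq_ltn_trans sp) //
           ltnS leq_pmulr.
Qed.

Lemma Gcoord_mulG i p : Gcoord i (p * G) = Gcoord i p * 'X.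
Proof.
apply/polyP=> j; rewrite coefMX !coef_Gcoord.
case: j => [|j] /=; first by rewrite expr0 divp1 modp_mull coef0.
by rewrite exprS -divp_divl mulpK ?G_neq0 // coef_Gcoord.
Qed.

Lemma Gcoord_sum p : p = \sum_(i < 4) (Gcoord i p \Po G) * 'X^i.
Proof.
have [n] := ubnP (size p); elim: n p => // n IHn p lt_pn.
have small (q : {poly 'F_2}) :
    (size q <= 4)%N -> q = \sum_(i < 4) (Gcoord i q \Po G) * 'X^i.
  move=> sq; under eq_bigr => i _ do
    rewrite Gcoord_small // comp_polyC mul_polyC.
  by rewrite -poly_def; apply/polyP=> j; rewrite coef_poly; case: ltnP => // ?;
     rewrite nth_default // (leq_trans sq).
have sr : (size (p %% G)%R <= 4)%N.
  by rewrite -ltnS (leq_trans (_ : _ < size G)%N) ?ltn_modp ?G_neq0 ?size_G.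
have [sp | sp] := leqP (size p) 4; first exact: small.
have ltn_aux a : (a < n.+1 -> 4 < a -> a - 4 < n)%N by lia.
have IHq : p %/ G = \sum_(i < 4) (Gcoord i (p %/ G) \Po G) * 'X^i.
  by apply: IHn; rewrite size_divp ?G_neq0 // size_G;
     exact: (ltn_aux _ lt_pn sp).
rewrite [LHS](divp_eq p G) [in LHS]IHq [p %% G in LHS]small //.
rewrite big_distrl -big_split.
apply: eq_bigr => i _ /=; rewrite [p in RHS](divp_eq p G) linearD /= Gcoord_mulG.
by rewrite comp_polyD comp_polyM comp_polyX mulrDl mulrAC.
Qed.

Lemma Gcoord_mulcG i k (g : {poly 'F_2}) :
  Gcoord i ((g \Po G) * 'X^(k : 'I_4)) = if i == k then g else 0.
Proof.
elim/poly_ind: g => [|g c IHg].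
  by rewrite comp_poly0 mul0r linear0; case: ifP.
rewrite comp_polyD comp_polyM comp_polyX comp_polyC mulrDl mulrAC linearD /=.
rewrite Gcoord_mulG IHg mul_polyC Gcoord_small; last first.
  by rewrite (leq_trans (size_scale_leq _ _)) // size_polyXn.
rewrite coefZ coefXn (inj_eq val_inj).
by case: ifP; rewrite ?mulr1 // mulr0 mul0r add0r polyC0.
Qed.

Lemma Gcoord_uniq (g : 'I_4 -> {poly 'F_2}) i :
  Gcoord i (\sum_(k < 4) (g k \Po G) * 'X^k) = g i.
Proof.
rewrite linear_sum /= (bigD1 i) //= big1 => [|k /negPf ki].
  by rewrite Gcoord_mulcG eqxx addr0.
by rewrite Gcoord_mulcG eq_sym ki.
Qed.

Lemma U_is_linear : linear U.
Proof.
move=> a p q; rewrite /U scaler_sumr -big_split; apply: eq_bigr => i _ /=.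
by rewrite linearP /= comp_polyD comp_polyZ mulrDl scalerAl.
Qed.
HB.instance Definition _ :=
  GRing.isLinear.Build 'F_2 {poly 'F_2} {poly 'F_2} _ U U_is_linear.

Lemma U_Xn (i : 'I_4) : U 'X^i = tnth U_basis i.
Proof.
have -> : 'X^i = (1 \Po G) * 'X^i by rewrite -polyC1 comp_polyC mul1r.
rewrite /U (bigD1 i) //= big1 => [|k /negPf ki]; rewrite Gcoord_mulcG.
  by rewrite eqxx -polyC1 comp_polyC mul1r addr0.
by rewrite ki comp_poly0 mul0r.
Qed.

Lemma U_sum (g : 'I_4 -> {poly 'F_2}) :
  U (\sum_(i < 4) (g i \Po G) * 'X^i) = \sum_(i < 4) (g i \Po F) * U 'X^i.
Proof. by apply: eq_bigr => i _; rewrite Gcoord_uniq U_Xn. Qed.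

Lemma size_U (p : {poly 'F_2}) : (size (U p) <= size p)%N.
Proof.
have s_U_basis (i : 'I_4) : (size (tnth U_basis i) <= i.+1)%N.
  rewrite (tnth_nth 0); case: i => [[|[|[|[|//]]]] ?] /=;
    rewrite ?size_poly1 ?size_polyX ?size_polyXn //.
  apply: (leq_trans (size_polyD _ _)); rewrite geq_max size_polyX andbT.
  by apply: (leq_trans (size_polyD _ _)); rewrite !size_polyXn.
rewrite /U (leq_trans (size_sum _ _ _)) //; apply/bigmax_leqP=> i _.
have [->|g_n0] := eqVneq (Gcoord i p) 0.
  by rewrite comp_poly0 mul0r size_poly0.
have bound : (4 * (size (Gcoord i p)).-1 + i.+1 <= size p)%N.
  set j := (size _).-1.
  have nz : (Gcoord i p)`_j != 0 by rewrite -lead_coefE lead_coef_eq0.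
  rewrite leqNgt; apply: contraNN nz; rewrite coef_Gcoord => lt_p.
  have aux sp : (sp < 4 * j + i.+1 -> sp - (4 * j).+1.-1 <= i)%N by lia.
  have s_d : (size (p %/ G ^+ j)%R <= i)%N.
    by rewrite size_divp ?expf_neq0 ?G_neq0 // size_GX; exact: aux.
  rewrite modp_small ?nth_default // size_G.
  by rewrite ltnS (leq_trans s_d) // ltnW // ltn_ord.
have bounds a b c sp : (4 * c + i.+1 <= sp -> a <= (c * 4).+1 -> b <= i.+1 ->
  (a + b).-1 <= sp)%N by lia.
apply: leq_trans (size_polyMleq _ _) (bounds _ _ _ _ bound _ (s_U_basis i)).
by apply: leq_trans (size_comp_poly_leq _ _) _; rewrite size_F.
Qed.

Lemma size_Lstar_elt m (g : {poly 'F_2}) :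
  (size g <= 4 * m + 4)%N -> (size (Lstar_elt g) <= 8 * m + 9)%N.
Proof.
move=> sg.
have aux a b c : (a <= 3 -> c <= 4 * m + 4 -> 0 < c -> b <= (c.-1 * 2).+1 ->
  (a + b).-1 <= 8 * m + 9)%N by lia.
have [->|g_n0] := eqVneq g 0.
  by rewrite /Lstar_elt comp_poly0 mulr0 size_poly0.
apply: leq_trans (size_polyMleq _ _) (aux _ _ _ _ sg _ _).
- by rewrite (leq_trans (size_polyD _ _)) // size_polyXn size_polyX.
- by rewrite size_poly_gt0.
by apply: leq_trans (size_comp_poly_leq _ _) _; rewrite size_polyXn.
Qed.

Lemma Lstar_map_linear m : linear (fun g : {poly_(4 * m + 4) 'F_2} =>
  npolyp (8 * m + 9) (Lstar_elt g)).
Proof.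
have trunc (g : {poly_(4 * m + 4) 'F_2}) :
    npolyp (8 * m + 9) (Lstar_elt g) = Lstar_elt g :> {poly 'F_2}.
  by rewrite npolypK // size_Lstar_elt // size_npoly.
move=> a p q; apply/val_inj; rewrite [LHS]trunc /= !trunc.
by rewrite /Lstar_elt comp_polyD comp_polyZ mulrDr scalerAr.
Qed.

Lemma U_map_linear m : linear (fun f : {poly_(8 * m + 9) 'F_2} =>
  npolyp (8 * m + 9) (U f)).
Proof.
have trunc (f : {poly_(8 * m + 9) 'F_2}) :
    npolyp (8 * m + 9) (U f) = U f :> {poly 'F_2}.
  by rewrite npolypK // (leq_trans (size_U _)) // size_npoly.
by move=> a p q; apply/val_inj; rewrite [LHS]trunc /= !trunc linearP.
Qed.

Lemma linfunE_of_linear (R : fieldType) (aT rT : vectType R) (f : aT -> rT) :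
  linear f -> linfun f =1 f.
Proof.
move=> f_lin; pose fM := GRing.isLinear.Build R aT rT _ f f_lin.
exact: (lfunE (HB.pack f fM : {linear aT -> rT})).
Qed.

Lemma mem_Lstar m (f : {poly_(8 * m + 9) 'F_2}) :
  f \in Lstar m <->
  exists2 g : {poly 'F_2},
    (size g <= 4 * m + 4)%N & val f = ('X^2 + 'X) * (g \Po 'X^2).
Proof.
split=> [/memv_imgP[g _ ->]|[g sg fE]].
  exists (val g); first exact: size_npoly.
  by rewrite (linfunE_of_linear (@Lstar_map_linear m)) /= npolypK
             ?size_Lstar_elt.
apply/memv_imgP; exists (npolyp _ g); first exact: memvf.
apply/val_inj; rewrite (linfunE_of_linear (@Lstar_map_linear m)) /= fE.
by rewrite !npolypK ?size_Lstar_elt.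
Qed.

Lemma mem_K m (f : {poly 'F_2}) :
  (exists2 v, v \in K m & val v = f) <->
  (exists2 g : {poly 'F_2},
     (size g <= 4 * m + 4)%N & f = ('X^2 + 'X) * (g \Po 'X^2)) /\ U f = f.
Proof.
have fixE (v : {poly_(8 * m + 9) 'F_2}) :
  v \in fixedSpace (linfun (fun f : {poly_(8 * m + 9) 'F_2} =>
                              npolyp (8 * m + 9) (U f))) <-> U (val v) = val v.
  split=> [/fixedSpaceP|Uv]; last (apply/fixedSpaceP; apply/val_inj);
    rewrite (linfunE_of_linear (@U_map_linear m)).
    by move/(congr1 val); rewrite /= npolypK ?(leq_trans (size_U _)).
  by rewrite /= npolypK ?(leq_trans (size_U _)).
split=> [[v /[!memv_cap]/andP[/mem_Lstar Lv /fixE Uv] <-] //|[Lf Uf]].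
have sf : (size f <= 8 * m + 9)%N.
  by case: Lf => g sg ->; exact: size_Lstar_elt.
exists (npolyp _ f); last by rewrite /= npolypK.
rewrite memv_cap; apply/andP; split.
  by apply/mem_Lstar; rewrite /= npolypK.
by apply/fixE; rewrite /= npolypK.
Qed.

(* Main.v *)
Require Import Defs.
From mathcomp Require Import all_boot all_order all_algebra.
From mathcomp Require Import zify ring.

(** Put [s = r^2 + r].  Then [s = F + G] and [s^4 = F G], so that [s] satisfies
    both [s^4 = F s + F^2] and [s^4 = G s + G^2].  As [U (G p) = F (U p)], the
    elements [w_k = U (s^k) - s^k] satisfy [w_(k+4) = F w_(k+1) + F^2 w_k], with
    [w_0 = w_1 = w_2 = 0] and [w_3 = F].  Hence for odd [k] the element [w_k] is
    an odd polynomial in [F] of small degree.  So [U - 1] maps the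
    [(2m+2)]-dimensional space of odd polynomials in [s] of degree at most
    [4m+3], which lies in [L^*], into the [(m+1)]-dimensional space of odd
    polynomials in [F] of degree at most [2m+1], and its kernel there has
    dimension at least [m+1]. *)

Set Implicit Arguments.
Unset Strict Implicit.
Unset Printing Implicit Defensive.

Import GRing.Theory.
Local Open Scope ring_scope.

(* Adding a suitable [p + p] to one side turns an identity that holds only in
   characteristic 2 into one that holds over the integers, hence into one that
   [ring] can prove. *)
Lemma addpp_F2 (p : {poly 'F_2}) : p + p = 0.
Proof. by apply: addrr_pchar2; rewrite pchar_poly; exact: pchar_Fp. Qed.

Lemma U_mulG p : U (p * G) = U p * F.
Proof.
rewrite /U mulr_suml; apply: eq_bigr => i _.
by rewrite Gcoord_mulG comp_polyM comp_polyX mulrAC.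
Qed.

Definition s : {poly 'F_2} := 'X^2 + 'X.

Lemma size_s : size s = 3%N.
Proof. by rewrite /s size_polyDl ?size_polyXn ?size_polyX. Qed.

Lemma s_neq0 : s != 0.
Proof. by rewrite -size_poly_eq0 size_s. Qed.

Lemma s_pow4_G : s ^+ 4 = s * G + G * G.
Proof.
by rewrite -[RHS]addr0 -(addpp_F2 ('X^5 * ('X + 1) ^+ 2)) /s /G; ring.
Qed.

Lemma s_pow4_F : s ^+ 4 = s * F + F * F.
Proof.
by rewrite -[LHS]addr0 -(addpp_F2 ('X^2 * ('X + 1) ^+ 5)) /s /F; ring.
Qed.

Definition w k : {poly 'F_2} := U (s ^+ k) - s ^+ k.

Lemma w_rec k : w k.+4 = F * w k.+1 + F ^+ 2 * w k.
Proof.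
have sG : s ^+ k.+4 = s ^+ k.+1 * G + s ^+ k * G * G.
  by rewrite -[k.+4]addn4 exprD s_pow4_G exprS; ring.
have sF : s ^+ k.+4 = s ^+ k.+1 * F + s ^+ k * F * F.
  by rewrite -[k.+4]addn4 exprD s_pow4_F exprS; ring.
by rewrite /w {1}sG linearD /= !U_mulG sF; ring.
Qed.

Lemma U_X k : (k < 4)%N -> U 'X^k = nth 0 U_basis k.
Proof. by move=> lt_k4; rewrite (U_Xn (Ordinal lt_k4)) (tnth_nth 0). Qed.

Lemma U1 : U 1 = 1.
Proof. by rewrite -(expr0 'X) (@U_X 0). Qed.

Lemma w0 : w 0 = 0.
Proof. by rewrite /w expr0 U1 subrr. Qed.

Lemma w1 : w 1 = 0.
Proof.
by rewrite /w expr1 /s linearD /= (U_X (k := 2)) // (U_X (k := 1)) //= subrr.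
Qed.

Lemma w2 : w 2 = 0.
Proof.
(* Dividing by [G] leaves only quotients and remainders of degree at most 3, where [U] is known. *)
have sG : s ^+ 2 = 1 * G + 'X^3 + 'X^2 by rewrite /s /G; ring.
rewrite /w {1}sG !linearD /= U_mulG U1 (U_X (k := 3)) // (U_X (k := 2)) //=.
by rewrite -(addpp_F2 ('X^3 + 'X^2 + 'X^2 + 'X)) /s /F; ring.
Qed.

Lemma w3 : w 3 = F.
Proof.
(* In characteristic 2, (r+1)^2 = r^2 + 1, and [U] fixes r^2 + 1. So [U (s ^+ 3)] is (r^2 + 1) F,
   against r^2 F for [s ^+ 3]. *)
have sG : s ^+ 3 = ('X^2 + 1) * G.
  by rewrite -[RHS]addr0 -(addpp_F2 ('X * G)) /s /G; ring.
have sF : s ^+ 3 = 'X^2 * F by rewrite /s /F; ring.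
by rewrite /w {1}sG U_mulG linearD /= U1 (U_X (k := 2)) //= sF; ring.
Qed.

(** Strong induction along [w_rec]: the factor F flips the parity in F, as passing from k+1 to k+4
    flips that of the index, while F^2 and the passage from k to k+4 preserve both. *)
Lemma w_parity k : exists2 c : {poly 'F_2},
  (size c <= (k %/ 4).+1)%N & w k = F ^+ odd k * (c \Po F ^+ 2).
Proof.
have [n] := ubnP k; elim: n k => // n IHn [|[|[|[|k]]]] lt_kn.
- by exists 0; rewrite ?size_poly0 // w0 comp_poly0 mulr0.
- by exists 0; rewrite ?size_poly0 // w1 comp_poly0 mulr0.
- by exists 0; rewrite ?size_poly0 // w2 comp_poly0 mulr0.
- by exists 1; rewrite ?size_poly1 // w3 -polyC1 comp_polyC mulr1 expr1.
have [c0 sz_c0 w_k] := IHn k ltac:(lia).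
have [c1 sz_c1 w_k1] := IHn k.+1 ltac:(lia).
(* ['X] stands for F^2. For even k, [w k.+1] already has a factor F, which [w_rec] completes to
   F^2. *)
exists ((if odd k then c1 else c1 * 'X) + c0 * 'X).
  have szX (c : {poly 'F_2}) : (size (c * 'X)%R <= (size c).+1)%N.
    by rewrite (leq_trans (size_polyMleq _ _)) // size_polyX addn2.
  rewrite (leq_trans (size_polyD _ _)) // geq_max; apply/andP; split.
    (* For even k, k+1 and k have the same quotient by 4, which leaves room for the extra ['X]. *)
    case: ifP => odd_k; last apply: (leq_trans (szX _)); lia.
  by apply: (leq_trans (szX _)); lia.
rewrite w_rec w_k w_k1 comp_polyD [odd k.+4]/= !negbK /=.
by case: (odd k); rewrite !comp_polyM !comp_polyX /=; ring.
Qed.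

Definition odd_s (h : {poly 'F_2}) : {poly 'F_2} := s * (h \Po s ^+ 2).

Lemma odd_s_linear : linear odd_s.
Proof.
by move=> a p q; rewrite /odd_s comp_polyD comp_polyZ mulrDr scalerAr.
Qed.

Lemma odd_s_inj : injective odd_s.
Proof.
move=> p q /(mulfI s_neq0)/eqP; rewrite -subr_eq0 -comp_polyB comp_poly_eq0.
  by rewrite subr_eq0 => /eqP.
by rewrite expr2 size_mul ?s_neq0 // size_s.
Qed.

(** In characteristic 2, s^2 = r^4 + r^2 is t^2 + t at t = r^2. *)
Lemma odd_s_Lstar_elt h : odd_s h = Lstar_elt (h \Po ('X^2 + 'X)).
Proof.
rewrite /odd_s /Lstar_elt -comp_polyA comp_polyD comp_Xn_poly comp_polyX.
by congr (_ * (_ \Po _)); rewrite -[RHS]addr0 -(addpp_F2 'X^3) /s; ring.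
Qed.

Lemma size_comp_s m (h : {poly 'F_2}) : (size h <= 2 * m + 2)%N ->
  (size (h \Po ('X^2 + 'X)) <= 4 * m + 4)%N.
Proof.
have [-> _|h_neq0 sz_h] := eqVneq h 0; first by rewrite comp_poly0 size_poly0.
have h_gt0 : (0 < size h)%N by rewrite size_poly_gt0.
rewrite (leq_trans (size_comp_poly_leq _ _)) // -/s size_s.
by lia.
Qed.

Lemma U_sub_odd_s m (h : {poly 'F_2}) : (size h <= 2 * m + 2)%N ->
  exists2 c : {poly 'F_2},
    (size c <= m.+1)%N & U (odd_s h) - odd_s h = F * (c \Po F ^+ 2).
Proof.
move=> sz_h.
have odd_sE : odd_s h = \sum_(i < 2 * m + 2) h`_i *: s ^+ (2 * i).+1.
  rewrite /odd_s comp_polyE big_distrr /=.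
  (* The added terms vanish, since coefficients beyond [size h] default to 0. *)
  rewrite (big_ord_widen _ (fun i => s * (h`_i *: (s ^+ 2) ^+ i)) sz_h).
  rewrite big_mkcond /=.
  apply: eq_bigr => i _; case: ltnP => [_|ge_i].
    by rewrite -scalerAr -exprM -exprS.
  by rewrite nth_default // scale0r.
have wE : U (odd_s h) - odd_s h = \sum_(i < 2 * m + 2) h`_i *: w (2 * i).+1.
  rewrite odd_sE linear_sum -sumrB; apply: eq_bigr => i _.
  by rewrite linearZ -scalerBr.
rewrite wE; apply: (big_ind (fun p : {poly 'F_2} => exists2 c : {poly 'F_2},
    (size c <= m.+1)%N & p = F * (c \Po F ^+ 2))).
- by exists 0; rewrite ?size_poly0 // comp_poly0 mulr0.
- move=> _ _ [c sz_c ->] [d sz_d ->]; exists (c + d).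
    by rewrite (leq_trans (size_polyD _ _)) // geq_max sz_c.
  by rewrite comp_polyD mulrDr.
move=> i _; have [c sz_c ->] := w_parity (2 * i).+1.
exists (h`_i *: c).
  apply: leq_trans (size_scale_leq _ _) (leq_trans sz_c _).
  (* The index 2i+1 is at most 4m+3, so its quotient by 4 is at most m. *)
  by have := ltn_ord i; lia.
have -> : odd (2 * i).+1 = true by lia.
by rewrite comp_polyZ scalerAr expr1.
Qed.

(** Rank-nullity for [f], whose rank is at most that of [g], hence at most the dimension of [X]. *)
Lemma dim_lker_limg_sub (k : fieldType) (V W X : vectType k)
    (f : 'Hom(V, W)) (g : 'Hom(X, W)) :
  (limg f <= limg g)%VS -> (\dim {:V} <= \dim (lker f) + \dim {:X})%N.
Proof.
move=> /dimvS le_fg; rewrite -(limg_ker_dim f fullv) capfv leq_add2l.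
by rewrite (leq_trans le_fg) // -(limg_ker_dim g fullv) leq_addl.
Qed.

Lemma npoly_hom (k : fieldType) (n1 n2 : nat) (f : {poly k} -> {poly k}) :
  linear f ->
  (forall p : {poly k}, (size p <= n1)%N -> (size (f p) <= n2)%N) ->
  exists phi : 'Hom({poly_n1 k}, {poly_n2 k}),
    forall p, val (phi p) = f (val p).
Proof.
move=> f_lin sz_f.
have trunc (p : {poly_n1 k}) : npolyp n2 (f p) = f p :> {poly k}.
  by rewrite npolypK // sz_f // size_npoly.
exists (linfun (fun p : {poly_n1 k} => npolyp n2 (f p))) => p.
rewrite linfunE_of_linear ?[LHS]trunc // => a u v.
by apply/val_inj; rewrite [LHS]trunc /= !trunc f_lin.
Qed.

Theorem theorem2p9 (m : nat) : (m + 1 <= \dim (K m))%N.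
Proof.
have sz_odd_s (h : {poly 'F_2}) : (size h <= 2 * m + 2)%N ->
    (size (odd_s h) <= 8 * m + 9)%N.
  by move=> sz_h; rewrite odd_s_Lstar_elt size_Lstar_elt ?size_comp_s.
have [A valA] := npoly_hom odd_s_linear sz_odd_s.
pose D h := U (odd_s h) - odd_s h.
have D_linear : linear D.
  by move=> a p q; rewrite /D !odd_s_linear linearP /= scalerBr opprD addrACA.
have sz_D (h : {poly 'F_2}) : (size h <= 2 * m + 2)%N ->
    (size (D h)%R <= 8 * m + 9)%N.
  move=> /sz_odd_s sz_h; rewrite (leq_trans (size_polyD _ _)) // geq_max.
  by rewrite size_polyN sz_h (leq_trans (size_U _)).
have [B valB] := npoly_hom D_linear sz_D.
pose odd_F c := F * (c \Po F ^+ 2).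
have odd_F_linear : linear odd_F.
  by move=> a p q; rewrite /odd_F comp_polyD comp_polyZ mulrDr scalerAr.
have sz_odd_F (c : {poly 'F_2}) : (size c <= m.+1)%N ->
    (size (odd_F c) <= 8 * m + 9)%N.
  have [-> _|c_neq0 sz_c] := eqVneq c 0.
    by rewrite /odd_F comp_poly0 mulr0 size_poly0.
  have sz_F2 : (size (F ^+ 2)%R).-1 = 8%N by rewrite size_exp size_F.
  have c_gt0 : (0 < size c)%N by rewrite size_poly_gt0.
  rewrite (leq_trans (size_polyMleq _ _)) // size_F.
  by have := size_comp_poly_leq c (F ^+ 2); rewrite sz_F2; lia.
have [C valC] := npoly_hom odd_F_linear sz_odd_F.
have le_BC : (limg B <= limg C)%VS.
  apply/subvP => _ /memv_imgP[h _ ->]; apply/memv_imgP.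
  have [c sz_c D_h] := U_sub_odd_s (size_npoly h).
  exists (npolyp m.+1 c); first exact: memvf.
  by apply/val_inj; rewrite valB valC /= npolypK.
(* Injectivity lets [A] carry [lker B] into [K m] without loss of dimension. *)
have A_inj : (fullv :&: lker A = 0)%VS.
  rewrite capfv; apply/eqP/lker0P => p q /(congr1 val).
  by rewrite !valA => /odd_s_inj/val_inj.
have AB_K : (A @: lker B <= K m)%VS.
  apply/subvP => _ /memv_imgP[h /[!memv_ker]/eqP Bh ->].
  have [|v vK vE] := (mem_K m (odd_s (val h))).2.
    split; last by apply/eqP; rewrite -subr_eq0 -/(D _) -valB Bh.
    exists (val h \Po ('X^2 + 'X)); last exact: odd_s_Lstar_elt.
    by rewrite size_comp_s ?size_npoly.
  by rewrite (_ : A h = v) //; apply/val_inj; rewrite valA vE.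
have dim_AB : \dim (A @: lker B) = \dim (lker B).
  by apply: limg_dim_eq; apply/eqP; rewrite -subv0 -A_inj capvS ?subvf.
(* This reads 2m+2 <= dim (ker B) + (m+1). *)
have := dim_lker_limg_sub le_BC; rewrite !dim_polyn => le_dim.
apply: leq_trans (dimvS AB_K); rewrite dim_AB -(leq_add2r m.+1).
by apply: leq_trans le_dim; lia.
Qed.
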